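(* As formal power series in $q$, \begin{align*} \sum_{m,n\ge0}\frac{q^{\frac{m(3m+1)}{2}+4mn+4n^2}(1+q^{2m+4n+1})}{(q;q)_m(q^2;q^2)_n} =\sum_{j\ge0}\frac{q^j}{(q^{10};q^{10})_{\lfloor j/2\rfloor}}\sum_{i=0}^{\lfloor j/2\rfloor}{\lfloor j/2\rfloor\brack i}_{q^{10}}\frac{(-q^3;q^{10})_{i+\lceil j/2\rceil-\lfloor j/2\rfloor}(-q^8;q^{10})_i}{(q^5;q^{10})_{i+\lceil j/2\rceil-\lfloor j/2\rfloor}}(q^6)^{\lfloor j/2\rfloor-i}, \end{align*} \begin{align*} \sum_{m,n\ge0}\frac{q^{\frac{m(3m+1)}{2}+4mn+4n^2+m+2n}(1+q^{2m+4n+2})}{(q;q)_m(q^2;q^2)_n} =\sum_{j\ge0}\frac{q^{2j}}{(q^{10};q^{10})_{\lfloor j/2\rfloor}}\sum_{i=0}^{\lfloor j/2\rfloor}{\lfloor j/2\rfloor\brack i}_{q^{10}}\frac{(-q;q^{10})_{i+\lceil j/2\rceil-\lfloor j/2\rfloor}(-q^6;q^{10})_i}{(q^5;q^{10})_{i+\lceil j/2\rceil-\lfloor j/2\rfloor}}(q^2)^{\lfloor j/2\rfloor-i}. \end{align*}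
   Context: $(a;p)_k=\prod_{i=0}^{k-1}(1-ap^i)$. For integers $0\le B\le A$, ${A\brack B}_p=\frac{(p;p)_A}{(p;p)_B(p;p)_{A-B}}$. $\lfloor\cdot\rfloor,\lceil\cdot\rceil$ are floor and ceiling. *)

(* Defs.v *)
From HB Require Import structures.
From mathcomp Require Import all_boot all_order all_algebra.
From mathcomp Require Import boolp.

Set Implicit Arguments.
Unset Strict Implicit.
Unset Printing Implicit Defensive.

Import GRing.Theory.
Local Open Scope ring_scope.

Record fps (R : Type) := FPS { fps_coef :> nat -> R }.

Lemma fpsP (R : Type) (f g : fps R) : (forall n, f n = g n) <-> f = g.
Proof.
split=> [|->//]; case: f g => [f] [g] /= fg.
by congr FPS; apply: funext.
Qed.

HB.instance Definition _ (R : Type) := gen_eqMixin (fps R).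
HB.instance Definition _ (R : Type) := gen_choiceMixin (fps R).

Section FpsRing.
Variable R : comNzRingType.
Implicit Types f g h : fps R.

Definition fps0 : fps R := FPS (fun _ => 0).
Definition fps_opp f : fps R := FPS (fun n => - f n).
Definition fps_add f g : fps R := FPS (fun n => f n + g n).
Definition fpsC (c : R) : fps R := FPS (fun n => if n == 0%N then c else 0).
Definition fps_mul f g : fps R :=
  FPS (fun n => \sum_(i < n.+1) f i * g (n - i)%N).

Lemma fps_addA : associative fps_add.
Proof. by move=> f g h; apply/fpsP=> n /=; rewrite addrA. Qed.
Lemma fps_addC : commutative fps_add.
Proof. by move=> f g; apply/fpsP=> n /=; rewrite addrC. Qed.
Lemma fps_add0 : left_id fps0 fps_add.
Proof. by move=> f; apply/fpsP=> n /=; rewrite add0r. Qed.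
Lemma fps_addN : left_inverse fps0 fps_opp fps_add.
Proof. by move=> f; apply/fpsP=> n /=; rewrite addNr. Qed.

HB.instance Definition _ :=
  GRing.isZmodule.Build (fps R) fps_addA fps_addC fps_add0 fps_addN.

Definition fps_trunc N f : {poly R} := \poly_(i < N) f i.

Lemma coef_fps_mul N f g n : (n < N)%N ->
  fps_mul f g n = (fps_trunc N f * fps_trunc N g)`_n.
Proof.
move=> nN; rewrite coefM /=; apply: eq_bigr => i _.
by rewrite !coef_poly !(leq_ltn_trans _ nN) ?leq_subr // -ltnS.
Qed.

Lemma fps_mulC : commutative fps_mul.
Proof.
by move=> f g; apply/fpsP=> n; rewrite !(@coef_fps_mul n.+1) // mulrC.
Qed.

Lemma fps_mulA : associative fps_mul.
Proof.
move=> f g h; apply/fpsP=> n.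
transitivity (fps_trunc n.+1 f * (fps_trunc n.+1 g * fps_trunc n.+1 h))`_n.
  rewrite coefM; apply: eq_bigr => i _; rewrite coef_poly ltn_ord.
  by rewrite (@coef_fps_mul n.+1) // ltnS leq_subr.
rewrite mulrA coefM; apply: eq_bigr => i _.
by rewrite coef_poly ltnS leq_subr (@coef_fps_mul n.+1).
Qed.

Lemma fps_mul1 : left_id (fpsC 1) fps_mul.
Proof.
move=> f; apply/fpsP=> n /=; rewrite big_ord_recl /= mul1r subn0.
by rewrite big1 ?addr0 // => i _; rewrite mul0r.
Qed.

Lemma fps_mulDl : left_distributive fps_mul fps_add.
Proof.
move=> f g h; apply/fpsP=> n /=; rewrite -big_split.
by apply: eq_bigr => i _; rewrite mulrDl.
Qed.

Lemma fps_1_neq0 : fpsC 1 != 0 :> fps R.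
Proof. by apply/eqP=> /fpsP/(_ 0%N)/eqP; rewrite /= oner_eq0. Qed.

HB.instance Definition _ := GRing.Zmodule_isComNzRing.Build (fps R)
  fps_mulA fps_mulC fps_mul1 fps_mulDl fps_1_neq0.

Definition fpsX : fps R := FPS (fun n => (n == 1%N)%:R).

Lemma coef_fps0 n : (0 : fps R) n = 0. Proof. by []. Qed.
Lemma coef_fps1 n : (1 : fps R) n = (n == 0%N)%:R.
Proof. by rewrite /=; case: eqP. Qed.
Lemma coef_fpsN f n : (- f) n = - f n. Proof. by []. Qed.
Lemma coef_fpsD f g n : (f + g) n = f n + g n. Proof. by []. Qed.
Lemma coef_fpsM f g n : (f * g) n = \sum_(i < n.+1) f i * g (n - i)%N.
Proof. by []. Qed.

Lemma coef_fpsXn m n : (fpsX ^+ m) n = (n == m)%:R.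
Proof.
elim: m n => [|m IHm] n; first by rewrite expr0 coef_fps1.
rewrite exprS coef_fpsM; case: n => [|n].
  by rewrite big_ord1 /= mul0r.
rewrite big_ord_recl mul0r add0r big_ord_recl /= mul1r subn1 /= IHm.
by rewrite big1 ?addr0 // => i _; rewrite mul0r.
Qed.

(* Unconditional summation for the q-adic topology with discrete coefficients:
   every coefficient is nonzero in only finitely many terms of the family. *)
Definition fps_has_sum (I : eqType) (F : I -> fps R) (S : fps R) : Prop :=
  forall k : nat, exists s : seq I,
    [/\ uniq s, forall i, F i k != 0 -> i \in s & S k = \sum_(i <- s) F i k].

Lemma fps_has_sum_unique (I : eqType) (F : I -> fps R) (S T : fps R) :
  fps_has_sum F S -> fps_has_sum F T -> S = T.
Proof.
move=> FS FT; apply/fpsP=> k.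
have [s [us Fs ->]] := FS k; have [t [ut Ft ->]] := FT k.
have nz r : \sum_(i <- r) F i k = \sum_(i <- r | F i k != 0) F i k.
  by rewrite [RHS]big_mkcond; apply: eq_bigr => i _; case: eqP.
rewrite (nz s) (nz t) -[LHS]big_filter -[RHS]big_filter; apply: perm_big.
apply: uniq_perm; rewrite ?filter_uniq // => i; rewrite !mem_filter.
by case: (boolP (F i k != 0)) => //= Fi; rewrite Fs ?Ft.
Qed.

End FpsRing.

Arguments fpsX {R}.

Section FpsUnitRing.
Variable R : comUnitRingType.
Implicit Types f g : fps R.

Definition fps_unit : pred (fps R) := fun f => f 0%N \is a GRing.unit.

(* Coefficients 0..n of 1/f, solved recursively from f * (1/f) = 1. *)
Fixpoint fps_inv_seq f n : seq R :=
  if n is m.+1 then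
    let s := fps_inv_seq f m in
    rcons s (- ((f 0%N)^-1 * \sum_(i < m.+1) f i.+1 * s`_(m - i)))
  else [:: (f 0%N)^-1].

Definition fps_inv f : fps R :=
  if fps_unit f then FPS (fun n => (fps_inv_seq f n)`_n) else f.

Lemma size_fps_inv_seq f n : size (fps_inv_seq f n) = n.+1.
Proof. by elim: n => //= n IHn; rewrite size_rcons IHn. Qed.

Lemma nth_fps_inv_seq f n i : (i <= n)%N ->
  (fps_inv_seq f n)`_i = (fps_inv_seq f i)`_i.
Proof.
elim: n => [|n IHn]; first by case: i.
rewrite leq_eqVlt => /predU1P[->//|]; rewrite ltnS => le_in.
by rewrite /= nth_rcons size_fps_inv_seq ltnS le_in IHn.
Qed.

Lemma fps_mulV : {in fps_unit, left_inverse 1 fps_inv *%R}.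
Proof.
move=> f; rewrite unfold_in => Uf; rewrite mulrC /fps_inv /fps_unit Uf.
apply/fpsP=> -[|n]; rewrite coef_fps1 coef_fpsM.
  by rewrite big_ord1 /= divrr.
rewrite big_ord_recl /= nth_rcons size_fps_inv_seq ltnn eqxx.
rewrite mulrN mulVKr //; apply/eqP; rewrite addrC subr_eq0; apply/eqP.
apply: eq_bigr => i _; rewrite /bump add1n subSS.
by rewrite [in RHS]nth_fps_inv_seq ?leq_subr.
Qed.

Lemma fps_unitP f g : g * f = 1 -> fps_unit f.
Proof.
move/fpsP/(_ 0%N); rewrite coef_fpsM big_ord1 /= => gf1.
by apply/unitrPr; exists (g 0%N); rewrite mulrC.
Qed.

Lemma fps_inv_out : {in [predC fps_unit], fps_inv =1 id}.
Proof.
by move=> f; rewrite inE /= unfold_in /fps_inv /fps_unit => /negPf ->.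
Qed.

HB.instance Definition _ := GRing.ComNzRing_hasMulInverse.Build (fps R)
  fps_mulV fps_unitP fps_inv_out.

Lemma fps_unitE f : (f \is a GRing.unit) = (f 0%N \is a GRing.unit).
Proof. by []. Qed.

End FpsUnitRing.

Definition qpoch (A : comUnitRingType) (a p : A) (k : nat) : A :=
  \prod_(i < k) (1 - a * p ^+ i).

(* Intended for b <= a and invertible denominators; otherwise subtraction
   truncates and x^-1 = x for non-units. *)
Definition qbinom (A : comUnitRingType) (p : A) (a b : nat) : A :=
  qpoch p p a / (qpoch p p b * qpoch p p (a - b)).

Lemma qpoch_fpsXn_unit (R : comUnitRingType) (a : fps R) m d k :
  (0 < m)%N -> qpoch (a * fpsX ^+ m) (fpsX ^+ d) k \is a GRing.unit.
Proof.
move=> m0; apply: rpred_prod => i _.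
rewrite fps_unitE coef_fpsD coef_fps1 coef_fpsN -mulrA mulrCA coef_fpsM.
by rewrite big_ord1 coef_fpsXn eq_sym -[m]prednK //= mul0r subr0 unitr1.
Qed.

(* Main.v *)
(* Both sides of the first identity are the Rogers-Ramanujan series
   G(q) = sum q^(N^2) / (q;q)_N, both sides of the second are
   H(q) = sum q^(N^2+N) / (q;q)_N.
   Left: the exponent is (m+2n)^2 + m(m+1)/2, and if c_N is the sum of
   q^(m(m+1)/2) / ((q;q)_m (q^2;q^2)_n) over m + 2n = N, then
   c_N + c_(N-1) = 1 / (q;q)_N.
   Right: splitting j by parity, the right-hand side is the Cauchy product of
   sum q^(8l) / (q^10;q^10)_l and sum q^j (-q^3;q^5)_j / (q^5;q^5)_j (and
   similarly for H), so the q-binomial theorem turns it into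
   1 / ((q;q^5)_oo (q^4;q^5)_oo), respectively 1 / ((q^2;q^5)_oo (q^3;q^5)_oo).
   What remains is the Rogers-Ramanujan identities, proved by Rogers's
   functional equations and Jacobi's triple product. *)
Require Import Defs.
From mathcomp Require Import all_boot all_order all_algebra.
From mathcomp Require Import ring zify.
From Stdlib Require Import Setoid Morphisms.

Set Implicit Arguments.
Unset Strict Implicit.
Unset Printing Implicit Defensive.

Import GRing.Theory.
Local Open Scope ring_scope.

(* Congruence modulo q^M. Infinite sums and products enter only through their
   truncations at M terms, which determine them modulo q^M. *)
Definition eqm (R : Type) (M : nat) (f g : fps R) : Prop :=
  forall k, (k < M)%N -> f k = g k.

(** * Congruence as a rewriting relation; [eqm M f 0] says that q^M divides [f] *)

Section Congruence.
Variable R : comUnitRingType.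
Implicit Types (f g h a p z : fps R) (M N K : nat).

#[global] Instance eqm_equiv M : Equivalence (@eqm R M).
Proof.
split=> [f k _ //|f g fg k kM|f g h fg gh k kM]; first by rewrite fg.
by rewrite fg ?gh.
Qed.

#[global] Instance eqm_add M :
  Proper (@eqm R M ==> @eqm R M ==> @eqm R M) (@GRing.add _).
Proof. by move=> f f' ff g g' gg k kM; rewrite !coef_fpsD ff ?gg. Qed.

#[global] Instance eqm_opp M : Proper (@eqm R M ==> @eqm R M) (@GRing.opp _).
Proof. by move=> f f' ff k kM; rewrite !coef_fpsN ff. Qed.

#[global] Instance eqm_mul M :
  Proper (@eqm R M ==> @eqm R M ==> @eqm R M) (@GRing.mul _).
Proof.
move=> f f' ff g g' gg k kM; rewrite !coef_fpsM; apply: eq_bigr => i _.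
rewrite ff ?gg //; [exact: leq_ltn_trans (leq_subr _ _) kM|].
by apply: leq_ltn_trans kM; rewrite -ltnS.
Qed.

Lemma eqm_sum M (I : Type) (r : seq I) (P : pred I) (F G : I -> fps R) :
  (forall i, P i -> eqm M (F i) (G i)) ->
  eqm M (\sum_(i <- r | P i) F i) (\sum_(i <- r | P i) G i).
Proof.
move=> FG; elim/big_rec2: _ => [|i x y Pi xy]; first reflexivity.
by rewrite xy FG //; reflexivity.
Qed.

Lemma eqm_sum0 M (I : Type) (r : seq I) (P : pred I) (F : I -> fps R) :
  (forall i, P i -> eqm M (F i) 0) -> eqm M (\sum_(i <- r | P i) F i) 0.
Proof.
move=> F0; elim/big_ind: _ => // x y x0 y0.
by rewrite x0 y0 addr0; reflexivity.
Qed.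

Lemma eqm_le M N f g : (M <= N)%N -> eqm N f g -> eqm M f g.
Proof. by move=> MN fg k kM; apply/fg/(leq_trans kM). Qed.

Lemma eqm_mulIu M h f g : h \is a GRing.unit -> eqm M (f * h) (g * h) -> eqm M f g.
Proof.
by move=> Uh fg; rewrite -[f](mulrK Uh) -[g](mulrK Uh) fg; reflexivity.
Qed.

Lemma eqm_unit f : eqm 1 f 1 -> f \is a GRing.unit.
Proof. by move=> f1; rewrite fps_unitE f1 // coef_fps1 unitr1. Qed.

Lemma eqm_sub0 M f g : eqm M (f - g) 0 -> eqm M f g.
Proof.
move=> fg0 k kM; apply/eqP.
by rewrite -subr_eq0 -coef_fpsN -coef_fpsD fg0.
Qed.

Lemma eqm0_mul M N f g : eqm M f 0 -> eqm N g 0 -> eqm (M + N) (f * g) 0.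
Proof.
move=> f0 g0 k kMN; rewrite coef_fpsM big1 // => i _.
have [iM|Mi] := ltnP i M; first by rewrite f0 // mul0r.
by rewrite g0 ?mulr0 //; have := ltn_ord i; lia.
Qed.

Lemma eqm_mul0l M N f g h :
  eqm M f 0 -> eqm N g h -> eqm (M + N) (f * g) (f * h).
Proof.
move=> f0 gh; have gh0 : eqm N (g - h) 0 by rewrite gh subrr; reflexivity.
move: (eqm0_mul f0 gh0); rewrite mulrBr; exact: eqm_sub0.
Qed.

Lemma eqm0_mulr M f g : eqm M f 0 -> eqm M (f * g) 0.
Proof. by move=> f0; rewrite f0 mul0r; reflexivity. Qed.

Lemma eqm0_mull M f g : eqm M g 0 -> eqm M (f * g) 0.
Proof. by move=> f0; rewrite f0 mulr0; reflexivity. Qed.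

Lemma eqm0_exp z n : eqm 1 z 0 -> eqm n (z ^+ n) 0.
Proof.
move=> z0; elim: n => [//|n IHn]; rewrite exprS -add1n.
exact: eqm0_mul.
Qed.

Lemma eqm0_Xn M n : (M <= n)%N -> eqm M (fpsX ^+ n : fps R) 0.
Proof. by move=> Mn k kM; rewrite coef_fpsXn; case: eqP => //; lia. Qed.

(** Multiplication by q only shifts coefficients, so it cancels even if [R] has zero divisors. The
    finite form of Jacobi's identity ends with such a cancellation. *)
Lemma lreg_fpsX : GRing.lreg (fpsX : fps R).
Proof.
move=> f g /fpsP fg; apply/fpsP=> n; move: (fg n.+1).
rewrite !coef_fpsM !(big_ord_recl n.+1) /= !mul0r !add0r.
by rewrite !big_ord_recl /= !mul1r !subSS !subn0 !big1 ?addr0 // => i _;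
   rewrite mul0r.
Qed.

End Congruence.

(** * q-Pochhammer symbols and the q-binomial theorem *)

Section QPoch.
Variable R : comUnitRingType.
Implicit Types (f g h a p z : fps R) (M N K : nat).

Lemma qpoch0 (A : comUnitRingType) (a p : A) : qpoch a p 0 = 1.
Proof. exact: big_ord0. Qed.

Lemma qpochSr (A : comUnitRingType) (a p : A) n :
  qpoch a p n.+1 = qpoch a p n * (1 - a * p ^+ n).
Proof. exact: big_ord_recr. Qed.

Lemma qpochSl (A : comUnitRingType) (a p : A) n :
  qpoch a p n.+1 = (1 - a) * qpoch (a * p) p n.
Proof.
rewrite /qpoch big_ord_recl mulr1; congr (_ * _).
by apply: eq_bigr => i _; rewrite exprS mulrA.
Qed.

Lemma qpoch_divSr (A : comUnitRingType) (a p : A) n :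
  qpoch a p n.+1 \is a GRing.unit ->
  (1 - a * p ^+ n) / qpoch a p n.+1 = (qpoch a p n)^-1.
Proof.
rewrite qpochSr unitrM => /andP[U V]; rewrite invrM // mulrA.
by rewrite divrr ?mul1r.
Qed.

Lemma qpoch_unit a p n : eqm 1 a 0 -> qpoch a p n \is a GRing.unit.
Proof.
move=> a0; apply: rpred_prod => i _; apply: eqm_unit.
by rewrite a0 mul0r subr0; reflexivity.
Qed.

(** Each further factor 1 - a p^i has i >= M and is 1 modulo q^M, so [qpoch a p M] stands for the
    infinite product modulo q^M. *)
Lemma qpoch_stable M K a p :
  (M <= K)%N -> eqm 1 p 0 -> eqm M (qpoch a p K) (qpoch a p M).
Proof.
move=> MK p0; elim: K MK => [|K IHK]; first by rewrite leqn0 => /eqP->.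
rewrite leq_eqVlt => /predU1P[-> //|]; rewrite ltnS => MK.
rewrite qpochSr IHK // (_ : eqm M (a * p ^+ K) 0) ?subr0 ?mulr1 //.
  exact/eqm0_mull/(eqm_le MK)/eqm0_exp.
Qed.

Lemma sum_stable M K (F : nat -> fps R) : (M <= K)%N ->
  (forall i, eqm i (F i) 0) -> eqm M (\sum_(i < K) F i) (\sum_(i < M) F i).
Proof.
move=> MK F0; rewrite -!(big_mkord xpredT) (big_cat_nat (n := M)) //=.
rewrite [X in _ + X]big_nat_cond.
rewrite (_ : eqm M (\sum_(M <= i < K | _) F i) 0) ?addr0; first reflexivity.
by apply: eqm_sum0 => i /andP[/andP[Mi _] _]; apply: eqm_le (F0 i).
Qed.

Lemma sum_triangle (A : comUnitRingType) K (F G : nat -> A) :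
  \sum_(k < K) \sum_(i < k.+1) F i * G (k - i)%N =
  \sum_(i < K) F i * \sum_(l < K - i) G l.
Proof.
elim: K => [|K IHK]; first by rewrite !big_ord0.
rewrite big_ord_recr IHK [RHS]big_ord_recr big_ord_recr /= subnn subSnn big_ord1.
rewrite addrA; congr (_ + _); rewrite -big_split; apply: eq_bigr => i _ /=.
by rewrite subSn ?big_ord_recr ?mulrDr // ltnW.
Qed.

(** In the triangle, [F i] meets the first K - i terms of [G]. The missing ones are divisible by
    q^(K-i) and [F i] by q^i. *)
Lemma sum_cauchy K (F G : nat -> fps R) :
  (forall i, eqm i (F i) 0) -> (forall i, eqm i (G i) 0) ->
  eqm K (\sum_(k < K) \sum_(i < k.+1) F i * G (k - i)%N)
        ((\sum_(i < K) F i) * (\sum_(i < K) G i)).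
Proof.
move=> F0 G0; rewrite sum_triangle mulr_suml; apply: eqm_sum => i _.
rewrite -[X in eqm X](@subnKC i) ?(ltnW (ltn_ord i)) //.
by apply: eqm_mul0l => //; symmetry; apply: sum_stable; rewrite ?leq_subr.
Qed.

Definition qbin_sum M a p z : fps R :=
  \sum_(j < M) z ^+ j * (qpoch a p j / qpoch p p j).

(** F(z) - F(pz) and z (F(z) - a F(pz)) are both sums of terms z^j t_j (1 - p^j), the second
    starting one index later. The term j = 0 is zero and the surplus last term contains z^M. *)
Lemma qbin_sum_step M a p z : eqm 1 z 0 -> eqm 1 p 0 ->
  eqm M (qbin_sum M a p z * (1 - z)) (qbin_sum M a p (z * p) * (1 - a * z)).
Proof.
move=> z0 p0; pose t j := qpoch a p j / qpoch p p j.
have Up n : qpoch p p n \is a GRing.unit by apply: qpoch_unit.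
have tS j : t j.+1 * (1 - p ^+ j.+1) = t j * (1 - a * p ^+ j).
  apply: (mulIr (Up j.+1)); rewrite /t mulrAC divrK //.
  by rewrite [in RHS]qpochSr -exprS mulrAC mulrA divrK // qpochSr mulrAC.
have dF : qbin_sum M a p z - qbin_sum M a p (z * p) =
    \sum_(j < M) z ^+ j * (t j * (1 - p ^+ j)).
  by rewrite -sumrB; apply: eq_bigr => i _; rewrite exprMn /t; ring.
have zF : z * (qbin_sum M a p z - a * qbin_sum M a p (z * p)) =
    \sum_(j < M) z ^+ j.+1 * (t j.+1 * (1 - p ^+ j.+1)).
  rewrite mulrBr !mulr_sumr -sumrB; apply: eq_bigr => i _.
  by rewrite tS exprMn exprS /t; ring.
apply: eqm_sub0; move: (qbin_sum M a p z) (qbin_sum M a p (z * p)) dF zF => f g dF zF.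
have -> : f * (1 - z) - g * (1 - a * z) = f - g - z * (f - a * g) by ring.
rewrite dF zF {dF zF}; case: M => [//|M].
rewrite big_ord_recl [X in _ - X]big_ord_recr /= expr0 subrr !mulr0 add0r.
rewrite (eqm0_mulr _ (eqm0_exp (n := M.+1) z0)) addr0 subrr; reflexivity.
Qed.

(** Iterating the functional equation carries z to z p^M, where only the term j = 0 survives modulo
    q^M. *)
Lemma qbinomial_series M a p z : eqm 1 z 0 -> eqm 1 p 0 ->
  eqm M (qbin_sum M a p z * qpoch z p M) (qpoch (a * z) p M).
Proof.
case: M => [//|M] z0 p0.
have zp n : eqm 1 (z * p ^+ n) 0 by rewrite z0 mul0r; reflexivity.
pose G n := qbin_sum M.+1 a p (z * p ^+ n).
have G0 : qbin_sum M.+1 a p z = G 0%N by rewrite /G expr0 mulr1.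
have GS n : eqm M.+1 (G n * (1 - z * p ^+ n)) (G n.+1 * (1 - a * z * p ^+ n)).
  by rewrite /G exprSr mulrA -[a * z * _]mulrA; apply: qbin_sum_step.
have GM : eqm M.+1 (G M.+1) 1.
  rewrite /G /qbin_sum big_ord_recl expr0 mul1r !qpoch0 divr1.
  rewrite (_ : eqm M.+1 (\sum_(_ < _) _) 0) ?addr0; first reflexivity.
  apply: eqm_sum0 => i _; apply: eqm0_mulr; rewrite lift0 (exprS (_ * _)).
  apply: eqm0_mulr; apply: eqm0_mull; exact: eqm0_exp.
rewrite G0; move: G GS GM {G0} => G GS GM.
suff step n : eqm M.+1 (G 0%N * qpoch z p n) (G n * qpoch (a * z) p n).
  by rewrite step GM mul1r; reflexivity.
elim: n => [|n IHn]; first by rewrite !qpoch0; reflexivity.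
by rewrite (qpochSr z) mulrA IHn mulrAC GS (qpochSr (a * z)) mulrAC
  [X in eqm _ _ X]mulrA; reflexivity.
Qed.

End QPoch.

(** * Rogers's functional equations *)

Section RogersRamanujan.
Variable R : comUnitRingType.
Implicit Types (M N K m n r s : nat).
Local Notation q := (fpsX : fps R).

(** G for s = 0 and H for s = 1; larger s serve the recursion. *)
Definition rr_sum M s : fps R :=
  \sum_(r < M) q ^+ (r * r + s * r) / qpoch q q r.

Lemma qpochXn_unit k d n : (0 < k)%N -> qpoch (q ^+ k) (q ^+ d) n \is a GRing.unit.
Proof. by move=> k0; apply/qpoch_unit/eqm0_Xn. Qed.

Lemma qpochX_unit n : qpoch q q n \is a GRing.unit.
Proof. exact: (@qpochXn_unit 1 1). Qed.

(** In the difference of the series at s and s + 1, the factor 1 - q^r cancels against (q;q)_r;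
    shifting r leaves q^(s+1) times the series at s + 2. *)
Lemma rr_sum_rec M s :
  eqm M (rr_sum M s) (rr_sum M s.+1 + q ^+ s.+1 * rr_sum M s.+2).
Proof.
apply: eqm_sub0; rewrite opprD addrA.
have -> : rr_sum M s - rr_sum M s.+1 =
    \sum_(r < M) q ^+ (r * r + s * r) * (1 - q ^+ r) / qpoch q q r.
  rewrite -sumrB; apply: eq_bigr => r _; rewrite -mulrBl; congr (_ / _).
  by rewrite mulrBr mulr1 -exprD; congr (_ - q ^+ _); lia.
rewrite mulr_sumr; case: M => [//|M].
rewrite big_ord_recl [X in _ - X]big_ord_recr /= expr0 subrr mulr0 mul0r add0r.
rewrite opprD addrA -sumrB big1 ?add0r => [|r _].
  rewrite mulrA -exprD eqm0_mulr ?oppr0; first reflexivity.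
  by apply: eqm0_Xn; lia.
apply/eqP; rewrite subr_eq0; apply/eqP/(mulIr (qpochX_unit r.+1)).
rewrite -[bump 0 r]/r.+1 divrK ?qpochX_unit // mulrA mulrAC -exprD qpochSr.
rewrite [qpoch q q r * _]mulrC mulrA mulrK ?qpochX_unit // -exprS; congr (q ^+ _ * _); lia.
Qed.

(* The terms of (q;q)_oo H_2(a) and (q;q)_oo H_1(a) at a = q^(s+1), where H_m are
   Rogers's series (Hardy and Wright, section 19.14). The exponents are those of
   a^(2r) q^(r(5r+1)/2 - m r), since r(5r+1)/2 = 5 C(r,2) + 3r. *)
Definition rr_term2 s r : fps R :=
  (-1) ^+ r * q ^+ (s * r * 2 + 'C(r, 2) * 5 + r * 3)
  * (1 - q ^+ (s.+1 * 2 + r * 4)) * qpoch (q ^+ r.+1) q s.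

Definition rr_term1 s r : fps R :=
  (-1) ^+ r * q ^+ (s * r * 2 + 'C(r, 2) * 5 + r * 4)
  * (1 - q ^+ (s.+1 + r * 2)) * qpoch (q ^+ r.+1) q s.

Lemma eqm_telescope M (t u A B : nat -> fps R) :
  B 0%N = 0 -> eqm M (B M) 0 -> (forall r, t r = A r + B r) ->
  (forall r, A r + B r.+1 = u r) ->
  eqm M (\sum_(r < M) t r) (\sum_(r < M) u r).
Proof.
move=> B0 BM tAB uAB.
rewrite (eq_bigr _ (fun (r : 'I_M) _ => tAB r)).
rewrite -(eq_bigr _ (fun (r : 'I_M) _ => uAB r)) !big_split /=.
have : \sum_(i < M.+1) B i = \sum_(i < M) B i + B M by rewrite big_ord_recr.
rewrite big_ord_recl B0 add0r => ->.
by rewrite BM addr0; reflexivity.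
Qed.

(** Rogers's H_1(a) = H_2(aq). In 1 - q^(s+1+2r) = q^r (1 - q^(r+s+1)) + (1 - q^r), the first factor
    extends the Pochhammer symbol on the right, the second on the left; the second part is then
    shifted by one index. *)
Lemma rr_term1_sum M s :
  eqm M (\sum_(r < M) rr_term1 s r) (\sum_(r < M) rr_term2 s.+1 r).
Proof.
apply: (@eqm_telescope M _ _
  (fun r => (-1) ^+ r * q ^+ (s.+1 * r * 2 + 'C(r, 2) * 5 + r * 3)
            * qpoch (q ^+ r.+1) q s.+1)
  (fun r => (-1) ^+ r * q ^+ (s.+1 * r * 2 + 'C(r, 2) * 5 + r * 2)
            * qpoch (q ^+ r) q s.+1)).
- by rewrite qpochSl subrr mul0r mulr0.
- by apply: eqm0_mulr; apply: eqm0_mull; apply: eqm0_Xn; lia.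
- move=> r; rewrite /rr_term1 qpochSr (qpochSl (q ^+ r)) -exprSr -exprD.
  rewrite !mulSn !addSn !(exprD, exprM, exprS, mulnDl).
  move: ((-1) ^+ r) (q ^+ r) (q ^+ s) (q ^+ 'C(r, 2)) => e Y S P.
  by move: (qpoch _ _ _) => Q; ring.
- move=> r; rewrite /rr_term2 binS bin1.
  rewrite !(mulSn, mulnS) !(addSn, addnS) !(exprD, exprM, exprS, mulnDl).
  move: ((-1) ^+ r) (q ^+ r) (q ^+ s) (q ^+ 'C(r, 2)) => e Y S P.
  by move: (qpoch _ _ _) => Q; ring.
Qed.

(** Rogers's H_2(a) = H_1(a) + a H_1(aq), from 1 - q^(2s+2+4r) = (1 - q^r) + q^r (1 - q^(s+1+2r)) +
    q^(s+1+3r) (1 - q^(s+1+r)), the first part being shifted. *)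
Lemma rr_term2_sum M s :
  eqm M (\sum_(r < M) rr_term2 s r)
    (\sum_(r < M) rr_term1 s r + q ^+ s.+1 * \sum_(r < M) rr_term1 s.+1 r).
Proof.
rewrite mulr_sumr -big_split /=.
apply: (@eqm_telescope M (rr_term2 s)
  (fun r => rr_term1 s r + q ^+ s.+1 * rr_term1 s.+1 r)
  (fun r => rr_term1 s r + q ^+ s.+1 *
            ((-1) ^+ r * q ^+ (s.+1 * r * 2 + 'C(r, 2) * 5 + r * 4)
            * qpoch (q ^+ r.+1) q s.+1))
  (fun r => (-1) ^+ r * q ^+ (s.+1 * r * 2 + 'C(r, 2) * 5 + r)
            * qpoch (q ^+ r) q s.+1)).
- by rewrite qpochSl subrr mul0r mulr0.
- by apply: eqm0_mulr; apply: eqm0_mull; apply: eqm0_Xn; lia.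
- move=> r; rewrite /rr_term1 /rr_term2 qpochSr (qpochSl (q ^+ r)) -exprSr -exprD.
  rewrite !mulSn !addSn !(exprD, exprM, exprS, mulnDl).
  move: ((-1) ^+ r) (q ^+ r) (q ^+ s) (q ^+ 'C(r, 2)) => e Y S P.
  by move: (qpoch _ _ _) => Q; ring.
- move=> r; rewrite /rr_term1 binS bin1 -addrA; congr (_ + _).
  rewrite !(mulSn, mulnS) !(addSn, addnS) !(exprD, exprM, exprS, mulnDl).
  move: ((-1) ^+ r) (q ^+ r) (q ^+ s) (q ^+ 'C(r, 2)) => e Y S P.
  by move: (qpoch _ _ _) => Q; ring.
Qed.

Lemma rr_term2_sum_rec M s :
  eqm M (\sum_(r < M) rr_term2 s r)
    (\sum_(r < M) rr_term2 s.+1 r + q ^+ s.+1 * \sum_(r < M) rr_term2 s.+2 r).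
Proof. by rewrite rr_term2_sum !rr_term1_sum; reflexivity. Qed.

(** Both sides satisfy the same recursion in s, and for s >= M both are (q;q)_M modulo q^M; hence a
    descending induction on s. *)
Lemma rr_term2_sumE M s :
  eqm M (\sum_(r < M) rr_term2 s r) (qpoch q q M * rr_sum M s).
Proof.
case: M => [//|M].
have base s' : (M < s')%N ->
    eqm M.+1 (\sum_(r < M.+1) rr_term2 s' r) (qpoch q q M.+1 * rr_sum M.+1 s').
  move=> Ms.
  have -> : eqm M.+1 (rr_sum M.+1 s') 1.
    rewrite /rr_sum big_ord_recl /= qpoch0 divr1 !muln0 addn0 expr0.
    rewrite [X in eqm _ (_ + X)]eqm_sum0 ?addr0; first reflexivity.
    move=> r _; rewrite -[bump 0 r]/r.+1; apply: eqm0_mulr; apply: eqm0_Xn; lia.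
  rewrite mulr1 big_ord_recl /=.
  rewrite [X in eqm _ (_ + X)]eqm_sum0 ?addr0; last first.
    move=> r _; rewrite -[bump 0 r]/r.+1 /rr_term2 -mulrA.
    by apply: eqm0_mulr; apply: eqm0_mull; apply: eqm0_Xn; lia.
  rewrite /rr_term2 muln0 !mul0n !addn0 !expr0 mul1r mul1r expr1.
  rewrite (eqm0_Xn _ (n := s'.+1 * 2)) ?subr0 ?mul1r; last by lia.
  by apply: qpoch_stable => //; exact: (@eqm0_Xn _ 1 1).
have [d] := ubnP (M.+1 - s); elim: d s => [//|d IHd] s sd.
have [/base//|sM] := ltnP M s.
rewrite rr_term2_sum_rec rr_sum_rec !IHd; [|lia|lia].
by rewrite mulrDr mulrCA; reflexivity.
Qed.

(** * The double sum *)

Definition ds_term m n : fps R :=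
  q ^+ 'C(m.+1, 2) / (qpoch q q m * qpoch (q ^+ 2) (q ^+ 2) n).

(* The sum over m + 2n = N - i, and 0 when N < i. *)
Definition ds_diag K N i : fps R :=
  \sum_(m < K) \sum_(n < K) if (m + 2 * n + i == N)%N then ds_term m n else 0.

Lemma ds_diagSS K N i : ds_diag K N.+1 i.+1 = ds_diag K N i.
Proof. by apply: eq_bigr => m _; apply: eq_bigr => n _; rewrite addnS eqSS. Qed.

Lemma ds_term_even m n :
  (1 - q ^+ (2 * n.+1)) * ds_term m n.+1 = ds_term m n.
Proof.
rewrite /ds_term !invrM ?qpochXn_unit ?qpochX_unit //.
rewrite -(@qpoch_divSr _ (q ^+ 2) (q ^+ 2) n) ?qpochXn_unit //.
by rewrite -exprM -exprD mulnS; ring.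
Qed.

Lemma ds_term_odd m n :
  (1 - q ^+ m.+1) * ds_term m.+1 n = q ^+ m.+1 * ds_term m n.
Proof.
rewrite /ds_term !invrM ?qpochXn_unit ?qpochX_unit //.
rewrite -(@qpoch_divSr _ q q m) ?qpochX_unit //.
by rewrite -exprS [in LHS]binS bin1 exprD; ring.
Qed.

(** Split 1 - q^(m+2n) as (1 - q^(2n)) + q^(2n) (1 - q^m): the first part lowers n by one and N by
    two, the second lowers m and N by one. *)
Lemma ds_diag_rec K N : (N < K)%N ->
  (1 - q ^+ N) * ds_diag K N 0 = ds_diag K N 2 + q ^+ N * ds_diag K N 1.
Proof.
case: K => [//|K] NK.
pose S (F : nat -> nat -> fps R) := \sum_(m < K.+1) \sum_(n < K.+1) F m n.
have -> : (1 - q ^+ N) * ds_diag K.+1 N 0 =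
  S (fun m n => if (m + 2 * n + 0 == N)%N then (1 - q ^+ (2 * n)) * ds_term m n else 0)
  + S (fun m n => if (m + 2 * n + 0 == N)%N
     then q ^+ (2 * n) * ((1 - q ^+ m) * ds_term m n) else 0).
  rewrite /S -big_split mulr_sumr; apply: eq_bigr => m _ /=.
  rewrite -big_split mulr_sumr; apply: eq_bigr => n _ /=.
  case: eqP => [<-|_]; last by rewrite mulr0 addr0.
  by rewrite addn0 exprD; ring.
congr (_ + _); last first.
  rewrite /S big_ord_recl /= [X in X + _]big1 => [|n _]; last first.
    by rewrite subrr mul0r mulr0 if_same.
  rewrite add0r /ds_diag [in RHS]big_ord_recr /= [X in _ * (_ + X)]big1 => [|n _].
    rewrite addr0 mulr_sumr; apply: eq_bigr => m _.
    rewrite mulr_sumr; apply: eq_bigr => n _; rewrite -[bump 0 m]/m.+1 ds_term_odd.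
    rewrite addn0 addn1 -addSn; case: eqP => [<-|_]; last by rewrite mulr0.
    by rewrite mulrA -exprD addnC.
  by case: eqP => //; lia.
rewrite /S /ds_diag; apply: eq_bigr => m _.
rewrite big_ord_recl [RHS]big_ord_recr /= muln0 expr0 subrr mul0r if_same add0r.
rewrite [X in _ + X]ifF ?addr0; last by apply/eqP; lia.
apply: eq_bigr => n _; rewrite -[bump 0 n]/n.+1 ds_term_even.
by congr (if _ == _ then _ else _); lia.
Qed.

(** The recursion turns (1 - q^(N+1)) (c_(N+1) + c_N) into c_N + c_(N-1). *)
Lemma ds_diagE K N : (N < K)%N ->
  ds_diag K N 0 + ds_diag K N 1 = (qpoch q q N)^-1.
Proof.
elim: N => [|N IHN] NK.
  case: K NK => [//|K] _; rewrite qpoch0 invr1 /ds_diag.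
  rewrite [X in _ + X]big1 => [|m _]; last first.
    by rewrite big1 // => n _; rewrite ifF //; lia.
  rewrite addr0 big_ord_recl /= [X in _ + X]big1 => [|m _]; last first.
    by rewrite big1.
  rewrite addr0 big_ord_recl /= [X in _ + X]big1 //.
  by rewrite addr0 /ds_term !qpoch0 mulr1 divr1.
apply: (mulrI (_ : 1 - q ^+ N.+1 \is a GRing.unit)).
  apply: eqm_unit; rewrite (eqm0_Xn _ (n := N.+1)) // subr0; reflexivity.
rewrite mulrDr ds_diag_rec // mulrBl mul1r !ds_diagSS.
rewrite [X in _ = X * _](_ : _ = 1 - q * q ^+ N) ?exprS //.
rewrite (@qpoch_divSr _ q q N) ?qpochX_unit // -IHN; last exact: ltnW.
by ring.
Qed.

(** With N = m + 2n, the weight is g(N) + g(N+1). Moving the second part to the next diagonal pairs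
    g(N) with c_N + c_(N-1). *)
Lemma ds_sumE M s :
  eqm M (\sum_(m < M) \sum_(n < M)
           q ^+ ((m + 2 * n) ^ 2 + s * (m + 2 * n))
           * (1 + q ^+ (2 * (m + 2 * n) + 1 + s)) * ds_term m n)
        (rr_sum M s).
Proof.
pose g N := q ^+ (N * N + s * N).
have gS N : g N * q ^+ (2 * N + 1 + s) = g N.+1.
  by rewrite /g -exprD; congr (q ^+ _); lia.
have g0 N : (M <= N)%N -> eqm M (g N) 0.
  by move=> MN; apply: eqm0_Xn; nia.
(* Collects the square by diagonals; its pairs with m + 2n >= M have weight zero modulo q^M. *)
have diag (h : nat -> fps R) : (forall N, (M <= N)%N -> eqm M (h N) 0) ->
    eqm M (\sum_(m < M) \sum_(n < M) h (m + 2 * n)%N * ds_term m n)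
          (\sum_(N < M) h N * ds_diag M N 0).
  move=> h0.
  have -> : \sum_(N < M) h N * ds_diag M N 0 = \sum_(m < M) \sum_(n < M)
      \sum_(N < M) h N * (if (m + 2 * n + 0 == N)%N then ds_term m n else 0).
    under eq_bigr do rewrite mulr_sumr; rewrite exchange_big /=.
    apply: eq_bigr => m _; under eq_bigr do rewrite mulr_sumr.
    by rewrite exchange_big.
  apply: eqm_sum => m _; apply: eqm_sum => n _.
  have [lt|ge] := ltnP (m + 2 * n) M; last first.
    rewrite [X in eqm _ _ X]big1 => [|N _].
      by apply: eqm0_mulr; apply: h0.
    by rewrite ifF ?mulr0 //; have := ltn_ord N; lia.
  rewrite (bigD1 (Ordinal lt)) //= addn0 eqxx big1 ?addr0; first reflexivity.
  move=> N; rewrite -val_eqE /= eq_sym => /negPf NE.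
  by rewrite NE mulr0.
have -> : \sum_(m < M) \sum_(n < M) q ^+ ((m + 2 * n) ^ 2 + s * (m + 2 * n))
           * (1 + q ^+ (2 * (m + 2 * n) + 1 + s)) * ds_term m n =
   \sum_(m < M) \sum_(n < M) (g (m + 2 * n)%N + g (m + 2 * n).+1) * ds_term m n.
  apply: eq_bigr => m _; apply: eq_bigr => n _.
  by rewrite -gS mulrDr mulr1 /g -mulnn.
rewrite (diag (fun N => g N + g N.+1)); last first.
  by move=> N MN; rewrite !g0 ?addr0 ?leqW //; reflexivity.
have -> : rr_sum M s = \sum_(N < M) g N * (ds_diag M N 0 + ds_diag M N 1).
  by apply: eq_bigr => N _; rewrite ds_diagE.
have -> : \sum_(N < M) (g N + g N.+1) * ds_diag M N 0 =
    \sum_(N < M) g N * ds_diag M N 0 + \sum_(N < M) g N.+1 * ds_diag M N.+1 1.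
  by rewrite -big_split; apply: eq_bigr => N _; rewrite mulrDl ds_diagSS.
have -> : \sum_(N < M) g N * (ds_diag M N 0 + ds_diag M N 1) =
    \sum_(N < M) g N * ds_diag M N 0 + \sum_(N < M) g N * ds_diag M N 1.
  by rewrite -big_split; apply: eq_bigr => N _; rewrite mulrDr.
apply: eqm_add; first reflexivity.
have : \sum_(i < M.+1) g i * ds_diag M i 1 =
    \sum_(i < M) g i * ds_diag M i 1 + g M * ds_diag M M 1 by rewrite big_ord_recr.
rewrite big_ord_recl /= {1}/ds_diag big1 => [|m _]; last first.
  by rewrite big1 // => n _; rewrite ifF //; lia.
rewrite mulr0 add0r => ->.
by rewrite (g0 M) // mul0r addr0; reflexivity.
Qed.

End RogersRamanujan.

(** * Jacobi's triple product *)

Lemma bin2D m n : 'C(m + n, 2) = ('C(m, 2) + 'C(n, 2) + m * n)%N.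
Proof. by elim: n => [|n IHn]; rewrite ?addnS ?binS ?bin1 ?IHn ?addn0; lia. Qed.

Lemma bin2_double n : ('C(n.+1, 2) + 'C(n.+1, 2))%N = (n.+1 * n)%N.
Proof. by elim: n => // n IHn; rewrite binS bin1; lia. Qed.

Section Jacobi.
Variable A : comUnitRingType.
Implicit Types (p d x y : A).

(** Induction by the q-Pascal rule, which comes from 1 - p^(N+1) = (1 - p^(N+1-i)) + p^(N+1-i) (1 -
    p^i). *)
Lemma qbinomial_homogeneous p d N : (forall n, qpoch p p n \is a GRing.unit) ->
  \prod_(i < N) (d - p ^+ i) =
  \sum_(i < N.+1) (-1) ^+ i * p ^+ 'C(i, 2) * d ^+ (N - i) * qbinom p N i.
Proof.
move=> Up; elim: N => [|N IHN].
  by rewrite big_ord0 big_ord1 /qbinom bin0n !qpoch0 !expr0 !mulr1 invr1 !mulr1.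
pose c i := (-1) ^+ i * p ^+ 'C(i, 2) * d ^+ (N.+1 - i)
            * (qpoch p p N / (qpoch p p i * qpoch p p (N.+1 - i))).
have split_term i : (i <= N.+1)%N ->
    (-1) ^+ i * p ^+ 'C(i, 2) * d ^+ (N.+1 - i) * qbinom p N.+1 i =
    (1 - p ^+ (N.+1 - i)) * c i + p ^+ (N.+1 - i) * (1 - p ^+ i) * c i.
  move=> iN; rewrite -mulrDl.
  have -> : 1 - p ^+ (N.+1 - i) + p ^+ (N.+1 - i) * (1 - p ^+ i) = 1 - p * p ^+ N.
    by rewrite mulrBr mulr1 -exprD subnK // addrA subrK exprS.
  by rewrite /qbinom qpochSr /c; ring.
have divS n z w : w \is a GRing.unit ->
    (1 - p ^+ n.+1) * (z / (w * qpoch p p n.+1)) = z / (w * qpoch p p n).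
  move=> Uw; rewrite exprS !invrM // -(qpoch_divSr (n := n)) //; ring.
rewrite big_ord_recr /= IHN mulr_suml.
rewrite (eq_bigr _ (fun (i : 'I_N.+2) _ => split_term i (ltn_ord i))) big_split /=.
rewrite [X in _ = X + _]big_ord_recr [X in _ = _ + X]big_ord_recl /=.
rewrite subnn expr0 subrr mulr0 !mul0r addr0 add0r -big_split.
apply: eq_bigr => i _; rewrite /= -[bump 0 i]/i.+1 /c /qbinom.
have iN : (i <= N)%N by rewrite -ltnS.
rewrite subSS subSn // [X in _ = X + _]mulrCA divS //.
rewrite -[X in _ = _ + X]mulrA [X in _ = _ + _ * X]mulrCA.
rewrite [qpoch p p i.+1 * _]mulrC divS // [qpoch p p (N - i) * _]mulrC.
have -> : d - p ^+ N = d - p ^+ (N - i) * p ^+ i by rewrite -exprD subnK.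
by rewrite binS bin1 exprD !exprS; ring.
Qed.

(* MacMahon's finite form: apply the homogeneous q-binomial theorem to
   prod_(i < 2n) (d - p^i) with d = p^(n-1) y, and cancel the common monomial m. *)
Lemma finite_jacobi p x y n : (forall n, qpoch p p n \is a GRing.unit) ->
  GRing.lreg x -> GRing.lreg y -> p = x * y ->
  qpoch x p n * qpoch y p n =
  \sum_(r < n.+1) (-1) ^+ r * p ^+ 'C(r, 2) * x ^+ r * qbinom p (n + n) (n + r)
  - \sum_(r < n) (-1) ^+ r * p ^+ 'C(r.+1, 2) * y ^+ r.+1
      * qbinom p (n + n) (n - r.+1).
Proof.
move=> Up x_reg y_reg pE.
case: n => [|n].
  by rewrite !qpoch0 big_ord1 big_ord0 /qbinom !qpoch0 !mulr1 invr1 !mulr1 subr0.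
have p_reg : GRing.lreg p by rewrite pE; apply: lregM.
(* From here [n] is the predecessor of the original one, and d x = p^(n+1). *)
pose d := p ^+ n * y; pose m := (-1) ^+ n.+1 * (p ^+ 'C(n.+1, 2) * d ^+ n.+1).
have m_reg : GRing.lreg m.
  apply: lregM; first exact: lreg_sign.
  by apply: lregM; apply: lregX => //; apply: lregM => //; apply: lregX.
have := qbinomial_homogeneous d (n.+1 + n.+1) Up.
rewrite big_split_ord /=.
(* Lower half: d - p^i = - p^i (1 - y p^(n-i)). *)
have -> : \prod_(i < n.+1) (d - p ^+ i) =
    (-1) ^+ n.+1 * p ^+ 'C(n.+1, 2) * qpoch y p n.+1.
  have -> : qpoch y p n.+1 = \prod_(i < n.+1) (1 - y * p ^+ (n - i)).
    by rewrite /qpoch (reindex_inj rev_ord_inj); apply: eq_bigr => i _.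
  rewrite -[X in (-1) ^+ X](card_ord n.+1) -[in RHS]prodr_const.
  rewrite -bin2_sum big_mkord -prodrXr -!big_split /=.
  apply: eq_bigr => i _.
  have -> : d = p ^+ (n - i) * p ^+ i * y by rewrite -exprD subnK // -ltnS.
  by ring.
(* Upper half: d - p^(n+1+i) = d (1 - x p^i). *)
have -> : \prod_(i < n.+1) (d - p ^+ (n.+1 + i)) = d ^+ n.+1 * qpoch x p n.+1.
  rewrite -[X in d ^+ X](card_ord n.+1) -[in RHS]prodr_const -big_split.
  by apply: eq_bigr => i _; rewrite /= /d exprD exprS {2}pE; ring.
(* Indices n + 1 + r will give the powers of x, and the reversed lower indices n - r those of y. *)
rewrite -addnS big_split_ord /= (reindex_inj rev_ord_inj) /= => E.
apply: m_reg.
have -> : m * (qpoch x p n.+1 * qpoch y p n.+1) =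
  (-1) ^+ n.+1 * p ^+ 'C(n.+1, 2) * qpoch y p n.+1 * (d ^+ n.+1 * qpoch x p n.+1).
  by rewrite /m; ring.
rewrite {}E mulrBr addrC !mulr_sumr -sumrN; congr (_ + _); apply: eq_bigr => r _.
  have := ltn_ord r; move: (nat_of_ord r) => {}r; rewrite ltnS => rn.
  have [e nE] : exists e, n.+1 = (e + r)%N.
    by exists (n.+1 - r)%N; rewrite subnK.
  rewrite [RHS]mulrA; congr (_ * qbinom p (n.+1 + n.+1) (n.+1 + r)).
  rewrite /m nE.
  rewrite (_ : e + r + (e + r) - (e + r + r) = e)%N; last by lia.
  have dr : d ^+ r * x ^+ r = p ^+ ((e + r) * r).
    rewrite -nE exprM -exprMn; congr (_ ^+ _).
    by rewrite /d exprSr {3}pE; ring.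
  rewrite bin2D !exprD -dr; ring.
have := ltn_ord r; move: (nat_of_ord r) => {}r; rewrite ltnS => rn.
have [e nE] : exists e, n = (e + r)%N by exists (n - r)%N; rewrite subnK.
rewrite [m * _]mulrA -mulNr subSS.
congr (_ * qbinom p (n.+1 + n.+1) (n - r)); rewrite /m.
rewrite (_ : n.+1 + n.+1 - (n - r) = n.+1 + r.+1)%N; last by lia.
have -> : 'C(n.+1, 2) = ('C(e, 2) + 'C(r.+1, 2) + e * r.+1)%N.
  by rewrite -bin2D nE addnS.
have dr : d ^+ r.+1 = p ^+ (e * r.+1) * p ^+ 'C(r.+1, 2) * p ^+ 'C(r.+1, 2) * y ^+ r.+1.
  rewrite /d exprMn -!exprM -!exprD; congr (p ^+ _ * _).
  by rewrite -addnA bin2_double nE mulnDl [(r.+1 * r)%N]mulnC.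
rewrite (_ : n - r = e)%N; last by rewrite nE addnK.
have -> : (-1) ^+ n.+1 = (-1) ^+ e * (-1) ^+ r.+1 :> A by rewrite -exprD nE addnS.
have sg : (-1) ^+ r * (-1) ^+ r = 1 :> A by rewrite -expr2 sqrr_sign.
move: 'C(r.+1, 2) dr => c dr.
rewrite -[LHS]mul1r -[X in X * _ = _]sg [d ^+ (_ + _)]exprD dr
  !exprD [(-1) ^+ r.+1]exprS; ring.
Qed.

End Jacobi.

(** * Jacobi's product in the limit, and the Rogers-Ramanujan identities *)

Section Products.
Variable R : comUnitRingType.
Implicit Types (a b p x y z f g : fps R) (M N K n s : nat).
Local Notation q := (fpsX : fps R).

Lemma eqm_inv M f g : f \is a GRing.unit -> g \is a GRing.unit ->
  eqm M f g -> eqm M f^-1 g^-1.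
Proof.
move=> Uf Ug fg; apply: (@eqm_mulIu _ M (f * g)); first by rewrite unitrM Uf.
rewrite mulKr // [f * g]mulrC mulKr // fg; reflexivity.
Qed.

Lemma qbinom_limit M N n p : eqm 1 p 0 -> (M <= n)%N -> (n + M <= N)%N ->
  eqm M (qpoch p p M * qbinom p N n) 1.
Proof.
move=> p0 Mn nN; have Up k : qpoch p p k \is a GRing.unit by apply: qpoch_unit.
have lim k : (M <= k)%N -> eqm M (qpoch p p k) (qpoch p p M).
  by move=> Mk; apply: qpoch_stable.
have inv : eqm M (qpoch p p n * qpoch p p (N - n))^-1 (qpoch p p M * qpoch p p M)^-1.
  apply: eqm_inv; rewrite ?unitrM ?Up //.
  by rewrite (lim n) // (lim (N - n)%N); [reflexivity|lia].
rewrite /qbinom inv lim ?(leq_trans Mn) //; last by lia.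
by rewrite mulrA divrr ?unitrM ?Up //; reflexivity.
Qed.

(** The summand pairs the indices r and -(r+1) of the bilateral series. The finite form is taken at
    n = 2M: for r < M its binomials are 1/(p;p)_M modulo q^M, and the terms with r >= M vanish. *)
Lemma jacobi_triple M p x y : GRing.lreg x -> GRing.lreg y -> p = x * y ->
  eqm 1 x 0 -> eqm 1 y 0 ->
  eqm M (\sum_(r < M) ((-1) ^+ r * p ^+ 'C(r, 2) * x ^+ r
                       - (-1) ^+ r * p ^+ 'C(r.+1, 2) * y ^+ r.+1))
        (qpoch p p M * qpoch x p M * qpoch y p M).
Proof.
move=> x_reg y_reg pE x0 y0.
have p0 : eqm 1 p 0 by rewrite pE x0 mul0r; reflexivity.
have Up k : qpoch p p k \is a GRing.unit by apply: qpoch_unit.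
have xr r : eqm r ((-1) ^+ r * p ^+ 'C(r, 2) * x ^+ r) 0.
  by apply: eqm0_mull; apply: eqm0_exp.
have yr r : eqm r ((-1) ^+ r * p ^+ 'C(r.+1, 2) * y ^+ r.+1) 0.
  by apply: eqm0_mull; apply: (eqm_le (leqnSn r)); apply: eqm0_exp.
set n := (M + M)%N.
have -> : eqm M (qpoch p p M * qpoch x p M * qpoch y p M)
                (qpoch p p M * (qpoch x p n * qpoch y p n)).
  by rewrite -mulrA [qpoch x p n]qpoch_stable ?leq_addr //
    [qpoch y p n]qpoch_stable ?leq_addr.
rewrite (@finite_jacobi _ p x y n) // mulrBr !mulr_sumr sumrB.
have c_lim (c : nat -> fps R) (h : nat -> nat) K : (M <= K)%N ->
    (forall r, eqm r (c r) 0) ->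
    (forall r, (r < M)%N -> (M <= h r)%N && (h r + M <= n + n)%N) ->
    eqm M (\sum_(r < K) qpoch p p M * (c r * qbinom p (n + n) (h r))) (\sum_(r < M) c r).
  move=> MK c0 hM.
  rewrite (@sum_stable _ M K (fun r => qpoch p p M * (c r * qbinom p (n + n) (h r)))) //.
    apply: eqm_sum => r _; case/andP: (hM r (ltn_ord r)) => h1 h2.
    by rewrite mulrCA qbinom_limit ?mulr1.
  by move=> r; apply: eqm0_mull; apply: eqm0_mulr.
rewrite (c_lim (fun r => (-1) ^+ r * p ^+ 'C(r, 2) * x ^+ r)
  (fun r => n + r)%N) //; first last.
- by move=> r rM; apply/andP; split; lia.
- by rewrite /n; lia.
rewrite (c_lim (fun r => (-1) ^+ r * p ^+ 'C(r.+1, 2) * y ^+ r.+1)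
  (fun r => n - r.+1)%N) //; first last.
- by move=> r rM; apply/andP; split; lia.
- by rewrite /n; lia.
Qed.

Lemma qpoch_dissect5 (A : comUnitRingType) (u : A) M :
  qpoch u u (5 * M) = qpoch u (u ^+ 5) M * qpoch (u ^+ 2) (u ^+ 5) M *
    qpoch (u ^+ 3) (u ^+ 5) M * qpoch (u ^+ 4) (u ^+ 5) M * qpoch (u ^+ 5) (u ^+ 5) M.
Proof.
elim: M => [|M IHM]; first by rewrite muln0 !qpoch0 !mulr1.
rewrite mulnS -[(5 + 5 * M)%N]/(5 * M).+4.+1 !qpochSr IHM -exprM !exprS; ring.
Qed.

Lemma eqm_qpoch5 M : eqm M (qpoch q q M) (qpoch q q (5 * M)).
Proof.
symmetry; apply: qpoch_stable; first by lia.
exact: (@eqm0_Xn _ 1 1).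
Qed.

Lemma eqm_of_eq M f g : f = g -> eqm M f g.
Proof. by move=> ->. Qed.

Lemma unitr_mul f g : f \is a GRing.unit -> g \is a GRing.unit ->
  f * g \is a GRing.unit.
Proof. by rewrite unitrM => ->. Qed.

(** Used with f = (q;q)_oo, g = G or H, [J] the theta series, [U] its Jacobi product and [W] the
    product over the remaining residues modulo 5. *)
Lemma eqm_cofactor M f g J (U W : fps R) : U \is a GRing.unit ->
  eqm M f (W * U) -> eqm M J (f * g) -> eqm M J U -> eqm M (g * W) 1.
Proof.
move=> unitU fE Jfg JU; apply: (@eqm_mulIu _ M U) => //.
rewrite mul1r; transitivity J; last exact: JU.
by rewrite Jfg fE; apply: eqm_of_eq; ring.
Qed.

Lemma rogers_ramanujan1 M :
  eqm M (rr_sum R M 0 * (qpoch q (q ^+ 5) M * qpoch (q ^+ 4) (q ^+ 5) M)) 1.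
Proof.
have reg k : GRing.lreg (q ^+ k) by apply: lregX; apply: lreg_fpsX.
have perm (a b c d e : fps R) : a * b * c * d * e = a * d * (e * c * b) by ring.
have := @jacobi_triple M (q ^+ 5) (q ^+ 3) (q ^+ 2) (reg 3) (reg 2)
  (exprD q 3 2) (@eqm0_Xn _ 1 3 isT) (@eqm0_Xn _ 1 2 isT).
apply: (@eqm_cofactor M (qpoch q q M)).
- by do 2?[apply: unitr_mul]; exact: qpochXn_unit.
- by rewrite -perm -qpoch_dissect5; exact: eqm_qpoch5.
(* At s = 0 the Pochhammer symbol of [rr_term2] is empty, leaving exactly the theta series. *)
rewrite -rr_term2_sumE; apply/eqm_of_eq/eq_bigr => r _.
rewrite /rr_term2 qpoch0 mulr1 binS bin1 mulrBr mulr1 -!mulrA -!exprM -!exprD.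
by congr (_ * q ^+ _ - _ * q ^+ _); lia.
Qed.

Lemma rogers_ramanujan2 M :
  eqm M (rr_sum R M 1 * (qpoch (q ^+ 2) (q ^+ 5) M * qpoch (q ^+ 3) (q ^+ 5) M)) 1.
Proof.
have reg k : GRing.lreg (q ^+ k) by apply: lregX; apply: lreg_fpsX.
have perm (a b c d e : fps R) : a * b * c * d * e = b * c * (e * d * a) by ring.
have := @jacobi_triple M (q ^+ 5) (q ^+ 4) (q ^+ 1) (reg 4) (reg 1)
  (exprD q 4 1) (@eqm0_Xn _ 1 4 isT) (@eqm0_Xn _ 1 1 isT).
apply: (@eqm_cofactor M (qpoch q q M)).
- by do 2?[apply: unitr_mul]; exact: qpochXn_unit.
- by rewrite -perm -qpoch_dissect5; exact: eqm_qpoch5.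
(* H_2(q^2) is traded for H_1(q), which brings s = 1 down to s = 0 and empties the Pochhammer
   symbol. *)
rewrite -rr_term2_sumE -rr_term1_sum; apply/eqm_of_eq/eq_bigr => r _.
rewrite /rr_term1 qpoch0 mulr1 binS bin1 mulrBr mulr1 -!mulrA -!exprM -!exprD.
by congr (_ * q ^+ _ - _ * q ^+ _); lia.
Qed.

End Products.

(** * The single sum *)

Section Bisection.
Variable R : comUnitRingType.
Implicit Types (a b p u v : fps R) (M K j k i : nat).

Lemma qpoch_even (A : comUnitRingType) (x p : A) i :
  qpoch x p i.*2 = qpoch x (p ^+ 2) i * qpoch (x * p) (p ^+ 2) i.
Proof.
elim: i => [|i IHi]; first by rewrite !qpoch0 mulr1.
by rewrite doubleS !qpochSr IHi -!exprM mul2n [p ^+ i.*2.+1]exprS; ring.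
Qed.

Lemma qpoch_odd (A : comUnitRingType) (x p : A) i :
  qpoch x p i.*2.+1 = qpoch x (p ^+ 2) i.+1 * qpoch (x * p) (p ^+ 2) i.
Proof. by rewrite !qpochSr qpoch_even -exprM mul2n; ring. Qed.

Lemma qpoch_squares (A : comUnitRingType) (x p : A) n :
  qpoch (- x) p n * qpoch x p n = qpoch (x ^+ 2) (p ^+ 2) n.
Proof.
rewrite -big_split; apply: eq_bigr => i _ /=.
by rewrite -exprM [(2 * i)%N]mulnC exprM; ring.
Qed.

Lemma sum_bisect (A : comUnitRingType) (F : nat -> A) K :
  \sum_(j < K.*2) F j = \sum_(k < K) (F k.*2 + F k.*2.+1).
Proof.
elim: K => [|K IHK]; first by rewrite !big_ord0.
by rewrite doubleS !big_ord_recr IHK /= addrA.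
Qed.

(* The summand of the right-hand sides, with p = q^5 and
   (a, u, v) = (-q^3, q, q^6), respectively (-q, q^2, q^2). *)
Definition rhs_term p a u v j : fps R :=
  u ^+ j / qpoch (p ^+ 2) (p ^+ 2) j./2
  * \sum_(0 <= i < (j./2).+1)
      qbinom (p ^+ 2) j./2 i
      * (qpoch a (p ^+ 2) (i + (uphalf j - j./2))%N * qpoch (a * p) (p ^+ 2) i
         / qpoch p (p ^+ 2) (i + (uphalf j - j./2))%N)
      * v ^+ (j./2 - i)%N.

Lemma rhs_term0 p a u v j : eqm 1 u 0 -> eqm j (rhs_term p a u v j) 0.
Proof. by move=> u0; apply: eqm0_mulr; apply: eqm0_mulr; apply: eqm0_exp. Qed.

(** The ring identity of the next lemma, with inverses as variables; only (p^2;p^2)_k, in the role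
    of [P], has to cancel. *)
Lemma cancel_inv (P P' L I A1 A2 B J1 J2 e1 e2 U V : fps R) : P * P' = 1 ->
  e1 * U * P' * (P * (L * I) * (A1 * B * J1) * V) +
  e2 * U * P' * (P * (L * I) * (A2 * B * J2) * V) =
  (e1 * (A1 * B * (I * J1)) + e2 * (A2 * B * (I * J2))) * (U * V * (1 * L)).
Proof. by move=> PP; rewrite -[RHS]mul1r -{1}PP; ring. Qed.

Definition qbin_term p a u j : fps R := u ^+ j * (qpoch a p j / qpoch p p j).

(** The base p^2 symbols combine to base p ones of length 2i or 2i + 1, and u^(2k) v^(k-i) = u^(2i)
    c^(k-i). *)
Lemma rhs_term_bisect p a u v c k : eqm 1 p 0 -> u ^+ 2 * v = c ->
  rhs_term p a u v k.*2 + rhs_term p a u v k.*2.+1 =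
  \sum_(i < k.+1) (qbin_term p a u i.*2 + qbin_term p a u i.*2.+1)
     * qbin_term (p ^+ 2) 0 c (k - i).
Proof.
move=> p0 <-.
have half1 : k.*2.+1./2 = k by rewrite -uphalfE uphalf_double.
have uphalf1 : uphalf k.*2.+1 = k.+1 by rewrite uphalfE -doubleS doubleK.
rewrite /rhs_term half1 uphalf1 doubleK uphalf_double subnn subSnn.
rewrite !big_mkord !mulr_sumr -big_split; apply: eq_bigr => i _ /=.
have ik : (i <= k)%N by rewrite -ltnS.
have p20 : eqm 1 (p ^+ 2) 0 by apply: eqm0_mulr.
have Up n : qpoch p (p ^+ 2) n \is a GRing.unit by apply: qpoch_unit.
have Up2 n : qpoch (p ^+ 2) (p ^+ 2) n \is a GRing.unit by apply: qpoch_unit.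
rewrite /qbin_term !qpoch_odd !qpoch_even -(expr2 p) addn0 addn1 /qbinom.
rewrite (_ : qpoch 0 _ _ = 1); last by rewrite /qpoch big1 // => l _; rewrite mul0r subr0.
rewrite !invrM ?unitr_mul //.
have -> : u ^+ k.*2 = u ^+ i.*2 * (u ^+ 2) ^+ (k - i).
  by rewrite -exprM -exprD; congr (u ^+ _); lia.
have -> : u ^+ k.*2.+1 = u ^+ i.*2.+1 * (u ^+ 2) ^+ (k - i).
  by rewrite -exprM -exprD; congr (u ^+ _); lia.
rewrite [(u ^+ 2 * v) ^+ _]exprMn; apply: cancel_inv; exact: divrr (Up2 k).
Qed.

(** The q-binomial theorem gives the Cauchy factors (-b;p)_oo / (u;p)_oo and 1 / (b^2;p^2)_oo, and
    (b^2;p^2)_oo = (b;p)_oo (-b;p)_oo. *)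
Lemma rhs_sum p a b u v M : eqm 1 p 0 -> eqm 1 u 0 -> eqm 1 b 0 ->
  a * u = - b -> u ^+ 2 * v = b ^+ 2 ->
  eqm M ((\sum_(j < M.*2) rhs_term p a u v j) * (qpoch u p M * qpoch b p M)) 1.
Proof.
move=> p0 u0 b0 au uv; pose w := qbin_term p a u.
have p20 : eqm 1 (p ^+ 2) 0 by apply: eqm0_mulr.
have b20 : eqm 1 (b ^+ 2) 0 by apply: eqm0_mulr.
pose l := qbin_term (p ^+ 2) 0 (b ^+ 2).
have w0 j : eqm j (w j) 0 by apply: eqm0_mulr; apply: eqm0_exp.
have l0 j : eqm j (l j) 0 by apply: eqm0_mulr; apply: eqm0_exp.
have -> : eqm M (\sum_(j < M.*2) rhs_term p a u v j)
    (qbin_sum M a p u * qbin_sum M 0 (p ^+ 2) (b ^+ 2)).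
  rewrite sum_bisect.
  have -> : \sum_(k < M) (rhs_term p a u v k.*2 + rhs_term p a u v k.*2.+1) =
      \sum_(k < M) \sum_(i < k.+1) (w i.*2 + w i.*2.+1) * l (k - i)%N.
    by apply: eq_bigr => k _; exact: rhs_term_bisect.
  rewrite (@sum_cauchy _ M (fun i => w i.*2 + w i.*2.+1) l) //; last first.
    move=> i; rewrite (@eqm_le _ i i.*2 (w i.*2) 0) // -?addnn ?leq_addr //.
    by rewrite add0r; apply: (@eqm_le _ i (i + i).+1) => //; lia.
  apply: eqm_mul; last by rewrite /qbin_sum; reflexivity.
  rewrite -(sum_bisect w M) /qbin_sum; apply: (@sum_stable _ M M.*2 w) => //.
  by rewrite -addnn leq_addr.
have L1 : eqm M (qbin_sum M 0 (p ^+ 2) (b ^+ 2) * qpoch (b ^+ 2) (p ^+ 2) M) 1.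
  rewrite qbinomial_series // mul0r /qpoch big1 //.
  by move=> i _; rewrite mul0r subr0.
have := @qbinomial_series _ M a p u u0 p0; rewrite au => W1.
apply: (@eqm_mulIu _ M (qpoch (b ^+ 2) (p ^+ 2) M)); first exact: qpoch_unit.
have := qpoch_squares b p M; move: (qpoch (b ^+ 2) (p ^+ 2) M) L1 W1.
move: (qbin_sum M a p u) (qbin_sum M 0 (p ^+ 2) (b ^+ 2)) (qpoch u p M) (qpoch b p M)
  (qpoch (- b) p M) => W L U B B' Q L1 W1 QE.
transitivity ((W * U) * (L * Q) * B); first by apply: eqm_of_eq; ring.
by rewrite W1 L1 mulr1 mul1r QE; reflexivity.
Qed.

End Bisection.

(** * From congruences to unconditional sums *)

Section Summability.
Variable R : comUnitRingType.

(** The bound 2M fits the summation by pairs 2k, 2k + 1. *)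
Lemma has_sum_nat (F : nat -> fps R) S :
  (forall j, eqm j (F j) 0) -> (forall M, eqm M S (\sum_(j < M.*2) F j)) ->
  fps_has_sum F S.
Proof.
move=> F0 SF k; exists (iota 0 k.+1.*2); split; first exact: iota_uniq.
  move=> j; apply: contraR; rewrite mem_iota add0n /= -leqNgt => kj.
  by apply/eqP; rewrite F0 //; lia.
rewrite (SF k.+1) // -(big_mkord xpredT F) /index_iota subn0.
by elim: (iota _ _) => [|j s IHs]; rewrite ?big_nil // !big_cons -IHs.
Qed.

Lemma has_sum_nat2 (F : nat * nat -> fps R) S :
  (forall m n, eqm (maxn m n) (F (m, n)) 0) ->
  (forall M, eqm M S (\sum_(m < M) \sum_(n < M) F (val m, val n))) ->
  fps_has_sum F S.
Proof.
move=> F0 SF k; exists [seq (m, n) | m <- iota 0 k.+1, n <- iota 0 k.+1]; split.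
- by apply: allpairs_uniq; rewrite ?iota_uniq // => -[? ?] [? ?] _ _ [-> ->].
- move=> [m n] Fk; apply/allpairs_f; rewrite mem_iota add0n /= ltnNge;
  apply: contraNN Fk => kmn; rewrite F0 ?leq_max ?kmn ?orbT //; exact: eqxx.
have sumE (G : nat -> fps R) s : (\sum_(i <- s) G i) k = \sum_(i <- s) G i k.
  by elim: s => [|j s IHs]; rewrite ?big_nil // !big_cons -IHs.
rewrite (SF k.+1) // big_allpairs -(big_mkord xpredT (fun m => \sum_(n < k.+1) F (m, val n))).
rewrite /index_iota subn0 sumE; apply: eq_bigr => m _.
by rewrite -(big_mkord xpredT (fun n => F (m, n))) /index_iota subn0 sumE.
Qed.

(** Terms with r > k do not reach q^k, so k + 1 terms determine this coefficient. *)
Definition rr_series s : fps R := FPS (fun k => rr_sum R k.+1 s k).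

Lemma rr_seriesE M s : eqm M (rr_series s) (rr_sum R M s).
Proof.
move=> k kM /=; symmetry; rewrite /rr_sum.
apply: (@sum_stable _ k.+1 M (fun r => fpsX ^+ (r * r + s * r) / qpoch fpsX fpsX r)) => // r.
by apply: eqm0_mulr; apply: eqm0_Xn; nia.
Qed.

Lemma double_sum_exponent m n :
  ((m * (3 * m + 1))./2 + 4 * m * n + 4 * n ^ 2)%N = ((m + 2 * n) ^ 2 + 'C(m.+1, 2))%N.
Proof.
have : (m * (3 * m + 1) = m * m + ('C(m.+1, 2)).*2 + m * m)%N.
  by rewrite -addnn bin2_double; lia.
by move=> ->; rewrite -!mulnn; lia.
Qed.

Lemma double_sum s (e : nat -> nat -> nat) :
  (forall m n, e m n = (m + 2 * n) ^ 2 + s * (m + 2 * n) + 'C(m.+1, 2))%N ->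
  fps_has_sum (fun mn : nat * nat =>
       let m := mn.1 in let n := mn.2 in
       (fpsX : fps R) ^+ e m n * (1 + fpsX ^+ (2 * m + 4 * n + s.+1)%N)
         / (qpoch fpsX fpsX m * qpoch (fpsX ^+ 2) (fpsX ^+ 2) n)) (rr_series s).
Proof.
move=> eE; apply: has_sum_nat2 => [m n|M] /=.
  apply: eqm0_mulr; apply: eqm0_mulr; apply: eqm0_Xn; rewrite eE geq_max; nia.
rewrite rr_seriesE -ds_sumE; apply: eqm_sum => m _; apply: eqm_sum => n _.
apply: eqm_of_eq; rewrite /ds_term eE [in RHS]exprD.
have -> : (2 * (m + 2 * n) + 1 + s = 2 * m + 4 * n + s.+1)%N by lia.
by rewrite -!mulrA; congr (_ * _); rewrite mulrCA.
Qed.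

Lemma rhs_term_has_sum p a b u v s :
  eqm 1 p 0 -> eqm 1 u 0 -> eqm 1 b 0 -> a * u = - b -> u ^+ 2 * v = b ^+ 2 ->
  (forall M, eqm M (rr_sum R M s * (qpoch u p M * qpoch b p M)) 1) ->
  fps_has_sum (rhs_term p a u v) (rr_series s).
Proof.
move=> p0 u0 b0 au uv rr; apply: has_sum_nat => [j|M]; first exact: rhs_term0.
have W : qpoch u p M * qpoch b p M \is a GRing.unit.
  by apply: unitr_mul; apply: qpoch_unit.
rewrite rr_seriesE; apply: (eqm_mulIu W).
by rewrite rr; symmetry; apply: rhs_sum.
Qed.

Lemma eq_has_sum (F G : nat -> fps R) S :
  F =1 G -> fps_has_sum F S -> fps_has_sum G S.
Proof.
move=> FG SF k; have [r [ur Fr ->]] := SF k; exists r; split=> // [i|].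
  by rewrite -FG; apply: Fr.
by apply: eq_bigr => i _; rewrite FG.
Qed.

End Summability.

Theorem theorem6p1 :
  let q : fps int := fpsX in
  (exists S : fps int,
     fps_has_sum (fun mn : nat * nat =>
       let m := mn.1 in let n := mn.2 in
       q ^+ ((m * (3 * m + 1))./2 + 4 * m * n + 4 * n ^ 2)%N
         * (1 + q ^+ (2 * m + 4 * n + 1)%N)
         / (qpoch q q m * qpoch (q ^+ 2) (q ^+ 2) n)) S
  /\ fps_has_sum (fun j : nat =>
       q ^+ j / qpoch (q ^+ 10) (q ^+ 10) j./2
       * \sum_(0 <= i < (j./2).+1)
           qbinom (q ^+ 10) j./2 i
           * (qpoch (- q ^+ 3) (q ^+ 10) (i + (uphalf j - j./2))%N
              * qpoch (- q ^+ 8) (q ^+ 10) i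
              / qpoch (q ^+ 5) (q ^+ 10) (i + (uphalf j - j./2))%N)
           * (q ^+ 6) ^+ (j./2 - i)%N) S)
  /\
  (exists S : fps int,
     fps_has_sum (fun mn : nat * nat =>
       let m := mn.1 in let n := mn.2 in
       q ^+ ((m * (3 * m + 1))./2 + 4 * m * n + 4 * n ^ 2 + m + 2 * n)%N
         * (1 + q ^+ (2 * m + 4 * n + 2)%N)
         / (qpoch q q m * qpoch (q ^+ 2) (q ^+ 2) n)) S
  /\ fps_has_sum (fun j : nat =>
       q ^+ (2 * j)%N / qpoch (q ^+ 10) (q ^+ 10) j./2
       * \sum_(0 <= i < (j./2).+1)
           qbinom (q ^+ 10) j./2 i
           * (qpoch (- q) (q ^+ 10) (i + (uphalf j - j./2))%N
              * qpoch (- q ^+ 6) (q ^+ 10) i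
              / qpoch (q ^+ 5) (q ^+ 10) (i + (uphalf j - j./2))%N)
           * (q ^+ 2) ^+ (j./2 - i)%N) S).
Proof.
move=> q.
have q0 k : (0 < k)%N -> eqm 1 (q ^+ k) 0 by apply: eqm0_Xn.
have q10 : (q ^+ 5) ^+ 2 = q ^+ 10 by rewrite -exprM.
split; [exists (rr_series int 0) | exists (rr_series int 1)]; split.
- apply: (@double_sum _ 0
    (fun m n => (m * (3 * m + 1))./2 + 4 * m * n + 4 * n ^ 2)%N) => m n.
  by rewrite double_sum_exponent mul0n addn0.
- apply: (@eq_has_sum _ (rhs_term (q ^+ 5) (- q ^+ 3) q (q ^+ 6))) => [j|].
    by rewrite /rhs_term q10 mulNr -exprD.
  (* Here a u = - q^4 and u^2 v = q^8, so b = q^4. *)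
  apply: (@rhs_term_has_sum _ _ _ (q ^+ 4)); rewrite ?q0 //.
  - exact: (q0 1%N).
  - by rewrite mulNr -exprSr.
  - by rewrite -exprM -exprD.
  - exact: rogers_ramanujan1.
- apply: (@double_sum _ 1
    (fun m n => (m * (3 * m + 1))./2 + 4 * m * n + 4 * n ^ 2 + m + 2 * n)%N) => m n.
  by rewrite -addnA double_sum_exponent; lia.
- apply: (@eq_has_sum _ (rhs_term (q ^+ 5) (- q) (q ^+ 2) (q ^+ 2))) => [j|].
    by rewrite /rhs_term q10 mulNr -exprS -exprM.
  (* Here a u = - q^3 and u^2 v = q^6, so b = q^3. *)
  apply: (@rhs_term_has_sum _ _ _ (q ^+ 3)); rewrite ?q0 //.
  - by rewrite mulNr -exprS.
  - by rewrite -!exprM -exprD.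
  - exact: rogers_ramanujan2.
Qed.
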